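(* Let $X$ be a vector space with a $\sigma$-algebra $\mathcal{F}$ and a topology $\tau$, let $(\mu_n)_{n\geqslant1}$ be a sequence of probability measures on $\mathcal{F}$ and $(v_n)_{n\geqslant1}$ a sequence of strictly positive reals. Suppose that $(\mu_n,v_n)_{n\geqslant1}$ satisfies (SAC) with, for every $x\in X$, $\mathcal{V}_x=\mathcal{C}_x$ the set of measurable open convex subsets of $X$ containing $x$. Let $Y$ be a vector space with a $\sigma$-algebra $\mathcal{G}$ and a topology $\sigma$ such that, for every $y\in Y$, the set $\mathcal{C}_y$ of measurable open convex neighbourhoods of $y$ is a fundamental system of neighbourhoods of $y$. Let $f:X\to Y$ be measurable, continuous and linear. Then $(\mu_n\circ f^{-1},v_n)_{n\geqslant1}$ satisfies (SAC) (with $\mathcal{V}_y=\mathcal{C}_y$ for every $y\in Y$). In particular, $(\mu_n\circ f^{-1},v_n)_{n\geqslant1}$ satisfies a weak large deviations principle.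
   Context: All topologies are Hausdorff; vector spaces are real; $\log0=-\infty$, $\sup\emptyset=-\infty$. Let $Z$ be a set with a $\sigma$-algebra $\mathcal{A}$ and a topology, $(\nu_n)_{n\geqslant1}$ probability measures on $\mathcal{A}$, $(v_n)_{n\geqslant1}$ strictly positive reals. (SAC), relative to a choice, for each $x\in Z$, of a fundamental system $\mathcal{V}_x$ of measurable neighbourhoods of $x$: for every $x\in Z$ and every $A\in\mathcal{V}_x$, $\liminf_{n\to\infty}\frac1{v_n}\log\nu_n(A)=\limsup_{n\to\infty}\frac1{v_n}\log\nu_n(A)$. The entropy is $s(x)=\inf\liminf_{n\to\infty}\frac1{v_n}\log\nu_n(A)$, infimum over $A\in\mathcal{A}$ whose interior contains $x$. $(\nu_n,v_n)_{n\geqslant1}$ satisfies a weak large deviations principle if for every relatively compact $K\in\mathcal{A}$, $\limsup_{n\to\infty}\frac1{v_n}\log\nu_n(K)\leqslant\sup_{\overline K}s$, with $\overline K$ the closure of $K$.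
   Formalization: The weak large deviations principle is stated under the added assumption that v_n tends to infinity; without it that clause fails (X=Y=R, f the identity, v_n=1, mu_n uniform on {0,1}, K={0,1}). The (SAC) conclusion needs no such assumption. *)

(* Defs.v *)
From HB Require Import structures.
From mathcomp Require Import all_boot all_order all_algebra.
From mathcomp Require Import all_classical all_reals all_analysis.

Set Implicit Arguments.
Unset Strict Implicit.
Unset Printing Implicit Defensive.

Import Order.TTheory GRing.Theory Num.Theory.
Import numFieldNormedType.Exports.

Local Open Scope classical_set_scope.
Local Open Scope ring_scope.

#[short(type="measurableTopologicalType")]
HB.structure Definition MeasurableTopological (d : measure_display) :=
  {T of Measurable d T & Topological T}.

Definition fundamental_system (T : topologicalType) (x : T)
    (B : set (set T)) : Prop :=
  (forall A, B A -> nbhs x A) /\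
  (forall U, nbhs x U -> exists2 A, B A & A `<=` U).

Section LargeDeviations.
Context {R : realType} {d : measure_display} {Z : measurableTopologicalType d}.
Variables (nu : nat -> probability Z R) (v : nat -> R).
Local Open Scope ereal_scope.

(* [lne 0 = -oo]. Sequences are meant to start at rank 1; the term of rank 0
   does not affect the limits below. *)
Definition log_rate (A : set Z) (n : nat) : \bar R :=
  ((v n)^-1)%:E * lne (nu n A).

Definition SAC (V : Z -> set (set Z)) : Prop :=
  [/\ forall x, fundamental_system x (V x),
      forall x A, V x A -> measurable A
    & forall x A, V x A -> limn_einf (log_rate A) = limn_esup (log_rate A)].

Definition entropy (x : Z) : \bar R :=
  ereal_inf [set limn_einf (log_rate A) |
             A in [set A : set Z | measurable A /\ A° x]].

Definition weak_LDP : Prop :=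
  forall K : set Z, measurable K -> compact (closure K) ->
    limn_esup (log_rate K) <= ereal_sup [set entropy x | x in closure K].

End LargeDeviations.

(* [X] with the sigma-algebra [F]. No compatibility is assumed between the
   sigma-algebra, the topology and the linear structure: [F] need not be the
   Borel sigma-algebra, and the vector space operations need not be continuous.
   The proof [sF] is a parameter so that the measurable sets are exactly the
   members of [F]. *)
Section MeasurableLmod.
Context {R : realType} {X : preTopologicalLmodType R} {F : set (set X)}.

Definition measurable_lmod (sF : sigma_algebra [set: X] F) : Type := X.

Variable sF : sigma_algebra [set: X] F.

HB.instance Definition _ := PreTopologicalLmodule.on (measurable_lmod sF).
HB.instance Definition _ := isPointed.Build (measurable_lmod sF) (0 : X).

Let F0 : F set0. Proof. by case: sF. Qed.

Let FC A : F A -> F (~` A).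
Proof. by case: sF => _ + _ FA => /(_ _ FA); rewrite setTD. Qed.

Let FU (A : (set X)^nat) : (forall i, F (A i)) -> F (\bigcup_i A i).
Proof. by case: sF => _ _; exact. Qed.

HB.instance Definition _ := @isMeasurable.Build default_measure_display
  (measurable_lmod sF) F F0 FC FU.

Definition open_convex_nbhs (x : measurable_lmod sF) :
    set (set (measurable_lmod sF)) :=
  [set C : set (measurable_lmod sF) |
    [/\ measurable C, open C, convex_set (C : set (measurable_lmod sF)) & C x]].

End MeasurableLmod.

Arguments open_convex_nbhs {R X F} sF x.

(* Main.v *)
Require Import Defs.
From HB Require Import structures.
From mathcomp Require Import all_boot all_order all_algebra.
From mathcomp Require Import all_classical all_reals all_analysis.

Set Implicit Arguments.
Unset Strict Implicit.
Unset Printing Implicit Defensive.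

Import Order.TTheory GRing.Theory Num.Theory.
Import numFieldNormedType.Exports.

Local Open Scope classical_set_scope.
Local Open Scope ring_scope.

(** The preimage under [f] of a measurable open convex set [C] is again
    measurable, open and convex, and the mass of [C] under the image measure is
    the mass of that preimage under [mu n]. If the preimage contains a point,
    (SAC) for [mu] at this point says that the two limits agree for [C];
    otherwise the mass of [C] vanishes and both limits are -oo. This is
    [SAC_distribution_linear], whose only geometric input is
    [convex_set_preimage].

    The weak large deviations principle follows from (SAC) over any space
    ([SAC_weak_LDP]), by a covering argument. Let [t] be a real number above
    the supremum of the entropy over the closure of [K]. Each point of this
    closure has a measurable neighbourhood whose lower rate is below [t]; it
    may be shrunk to a set of the fundamental system, and there (SAC) makes the
    upper rate smaller than [t] as well. Finitely many of these sets
    cover [K], and a finite union of sets with upper rate at most [t] has upper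
    rate at most [t] ([limn_esup_log_rateU]): a factor 2 in the masses
    contributes [ln 2 / v n] to the rate, which tends to 0. *)

Section LimitSuperior.
Context {R : realType}.
Implicit Types u w : (\bar R)^nat.
Local Open Scope ereal_scope.

Lemma limn_esup_lt_near u (t : \bar R) :
  limn_esup u < t -> \forall n \near \oo, u n < t.
Proof.
move=> /ereal_inf_lt[_ [V V_oo <-]] supV; apply: filterS V_oo => n Vn.
by apply: le_lt_trans supV; apply: ereal_sup_ubound; exists n.
Qed.

Lemma limn_esup_le_near u (t : \bar R) :
  (\forall n \near \oo, u n <= t) -> limn_esup u <= t.
Proof.
move=> ut; apply: ge_ereal_inf; eexists; first by eexists; first exact: ut.
by apply: ge_ereal_sup => _ [n un <-].
Qed.

Lemma limn_esup_le_homo u w :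
  (\forall n \near \oo, u n <= w n) -> limn_esup u <= limn_esup w.
Proof.
move=> uw; apply: le_ereal_inf_tmp => _ [V V_oo <-]; apply: ge_ereal_inf.
exists (ereal_sup [set u n | n in V `&` [set n | u n <= w n]]).
  by exists (V `&` [set n | u n <= w n]) => //; exact: filterI.
apply: ge_ereal_sup => _ [n [Vn uwn] <-]; apply: le_trans uwn _.
by apply: ereal_sup_ubound; exists n.
Qed.

Lemma limn_einf_le_homo u w :
  (\forall n \near \oo, u n <= w n) -> limn_einf u <= limn_einf w.
Proof.
move=> uw; rewrite leeN2; apply: limn_esup_le_homo.
by apply: filterS uw => n uwn; rewrite leeN2.
Qed.

(** Reduces an inequality to real bounds on the right, so that the case of an
    infinite [y] is treated only once. *)
Lemma lee_fin_ub (x y : \bar R) :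
  (forall t : R, y < t%:E -> x <= t%:E) -> x <= y.
Proof.
case: y => [r| |] xt; last 2 first.
- exact: leey.
- by rewrite leeNy_eq; apply/eqP/eq_ninfty => t; apply/xt/ltNyr.
by apply/lee_addgt0Pr => e e0; apply: xt; rewrite lte_fin ltrDl.
Qed.

End LimitSuperior.

Section LargeDeviations.
Context {R : realType} {d : measure_display} {Z : measurableTopologicalType d}.
Variables (nu : nat -> probability Z R) (v : nat -> R).
Hypothesis v_gt0 : forall n, (1 <= n)%N -> 0 < v n.
Local Open Scope ereal_scope.

Let near_v_gt0 : \forall n \near \oo, (0 < v n)%R.
Proof. by exists 1%N => // n; exact: v_gt0. Qed.

(** Trades a bound on the rate for a bound on the mass, where unions can be
    handled by subadditivity. *)
Lemma log_rate_le A n (s : R) : (0 < v n)%R ->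
  (log_rate nu v A n <= s%:E) = (nu n A <= (expR (v n * s))%:E).
Proof.
move=> vn0; rewrite /log_rate lee_pdivrMl// -EFinM -lee_expeR lneK//.
by rewrite in_itv/= measure_ge0 leey.
Qed.

Lemma near_le_log_rate A B : measurable A -> measurable B -> A `<=` B ->
  \forall n \near \oo, log_rate nu v A n <= log_rate nu v B n.
Proof.
move=> mA mB AB; apply: filterS near_v_gt0 => n vn0.
rewrite /log_rate lee_wpmul2l ?lee_fin ?invr_ge0 ?(ltW vn0)//.
rewrite lee_lne ?in_itv/= ?measure_ge0 ?leey//.
by apply: le_measure; rewrite ?inE.
Qed.

Lemma near_log_rate0 : \forall n \near \oo, log_rate nu v set0 n = -oo.
Proof.
apply: filterS near_v_gt0 => n vn0; rewrite /log_rate measure0 le0_lneNy//.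
by rewrite gt0_muleNy// lte_fin invr_gt0.
Qed.

Lemma limn_einf_log_rate0 : limn_einf (log_rate nu v set0) = -oo.
Proof.
apply/eqP; rewrite -leeNy_eq; apply: le_trans (limn_einf_sup _) _.
by apply: limn_esup_le_near; apply: filterS near_log_rate0 => n ->.
Qed.

Lemma limn_esup_log_rate0 : limn_esup (log_rate nu v set0) = -oo.
Proof.
apply/eqP; rewrite -leeNy_eq.
by apply: limn_esup_le_near; apply: filterS near_log_rate0 => n ->.
Qed.

(** The exponential growth of a sum is that of its largest term: doubling a mass
    below [expR (v n * (t + e / 2))] keeps it below [expR (v n * (t + e))] as
    soon as [ln 2 <= v n * (e / 2)]. *)
Lemma limn_esup_log_rateU A B (t : R) : v @ \oo --> +oo%R ->
  measurable A -> measurable B ->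
  limn_esup (log_rate nu v A) <= t%:E -> limn_esup (log_rate nu v B) <= t%:E ->
  limn_esup (log_rate nu v (A `|` B)) <= t%:E.
Proof.
move=> v_oo mA mB supA supB; apply/lee_addgt0Pr => e e0.
have near_lt C : limn_esup (log_rate nu v C) <= t%:E ->
    \forall n \near \oo, log_rate nu v C n < (t + e / 2)%:E.
  move=> supC; apply: limn_esup_lt_near; apply: le_lt_trans supC _.
  by rewrite lte_fin ltrDl divr_gt0.
apply: limn_esup_le_near.
have near_ln2 : \forall n \near \oo, (ln 2 / (e / 2) < v n)%R.
  by move/cvgryPgt : v_oo; exact.
near=> n.
have vn0 : (0 < v n)%R by near: n.
have lnn : (ln 2 < v n * (e / 2))%R.
  by rewrite -ltr_pdivrMr ?divr_gt0//; near: n.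
rewrite -EFinD log_rate_le//; apply: le_trans (measureU2 _ mA mB) _.
have nuC C : log_rate nu v C n < (t + e / 2)%:E ->
    nu n C <= (expR (v n * (t + e / 2)))%:E.
  by move=> /ltW; rewrite log_rate_le.
apply: (le_trans (leeD (nuC A _) (nuC B _))); [by near: n; exact: near_lt..|].
rewrite -EFinD lee_fin -mulr2n -[leLHS]mulr_natl.
rewrite -[X in (X * _ <= _)%R]lnK ?posrE//.
have -> : (v n * (t + e) = v n * (e / 2) + v n * (t + e / 2))%R.
  by rewrite -mulrDr addrCA -splitr.
by rewrite -expRD ler_expR lerD2r ltW.
Unshelve. all: by end_near. Qed.

Lemma limn_esup_log_rate_bigsetU (I : Type) (s : seq I) (C : I -> set Z)
    (t : R) : v @ \oo --> +oo%R -> (forall i, measurable (C i)) ->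
  (forall i, limn_esup (log_rate nu v (C i)) <= t%:E) ->
  limn_esup (log_rate nu v (\big[setU/set0]_(i <- s) C i)) <= t%:E.
Proof.
move=> v_oo mC supC; elim: s => [|i s IHs].
  by rewrite big_nil limn_esup_log_rate0 leNye.
by rewrite big_cons limn_esup_log_rateU//; exact: bigsetU_measurable.
Qed.

(** (SAC) is what turns a neighbourhood witnessing a small entropy, which only
    bounds a limit inferior, into one with a small limit superior. The limit
    superior is needed because the finitely many sets covering [K] must have
    small mass at the same ranks. *)
Lemma SAC_weak_LDP V : SAC nu v V -> v @ \oo --> +oo%R -> weak_LDP nu v.
Proof.
move=> [fundV mV eqV] v_oo K mK cK; set S := ereal_sup _.
apply: lee_fin_ub => t St.
(* Points outside the closure of [K] receive the empty set, so that the family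
   of neighbourhoods is measurable and small at every index. *)
have small x : exists A, [/\ measurable A,
    limn_esup (log_rate nu v A) <= t%:E & closure K x -> nbhs x A].
  have [Kx|nKx] := pselect (closure K x); last first.
    by exists set0; split=> //; rewrite limn_esup_log_rate0 leNye.
  have /ereal_inf_lt[_ [A [mA Ax] <-] At] : entropy nu v x < t%:E.
    by apply: le_lt_trans St; apply: ereal_sup_ubound; exists x.
  have [C VC CA] := (fundV x).2 _ Ax; have mC := mV _ _ VC.
  exists C; split=> // [|_]; last exact: (fundV x).1.
  rewrite -(eqV _ _ VC); apply/ltW/(le_lt_trans _ At).
  by apply: limn_einf_le_homo; exact: near_le_log_rate.
have /choice[A /all_and3[mA supA nbhsA]] := small.
move: cK; rewrite compact_cover => /(_ Z (closure K) (fun x => (A x)°)).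
case=> [x _|x Kx|D _ KD]; first exact: open_interior.
  by exists x => //; exact: nbhsA.
have {}KD : K `<=` \big[setU/set0]_(x <- finmap.enum_fset D) A x.
  rewrite -bigcup_fset => x /subset_closure/KD[y Dy Ayx].
  by exists y => //; exact: interior_subset.
apply: le_trans (limn_esup_log_rate_bigsetU (finmap.enum_fset D) v_oo mA supA).
apply: limn_esup_le_homo; apply: near_le_log_rate => //.
exact: bigsetU_measurable.
Qed.

End LargeDeviations.

Lemma convex_set_preimage (R : realType) (X Y : lmodType R) (f : X -> Y)
    (C : set Y) :
  linear f -> convex_set (C : set (convex_lmodType Y)) ->
  convex_set (f @^-1` C : set (convex_lmodType X)).
Proof.
move=> f_lin cC x y p; rewrite !inE => Cx Cy.
have f0 : f 0 = 0.
  by have := f_lin (-1) 0 0; rewrite scaler0 addr0 scaleN1r addNr.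
have fZ a z : f (a *: z) = a *: f z by rewrite -[a *: z]addr0 f_lin f0 addr0.
have := cC (f x) (f y) p; rewrite !inE => /(_ Cx Cy).
by rewrite /= /conv/= f_lin fZ.
Qed.

Lemma SAC_distribution_linear (R : realType)
  (X : preTopologicalLmodType R) (F : set (set X))
  (sF : sigma_algebra [set: X] F)
  (mu : nat -> probability (measurable_lmod sF) R) (v : nat -> R)
  (v_gt0 : forall n, (1 <= n)%N -> 0 < v n)
  (SAC_mu : SAC mu v (open_convex_nbhs sF))
  (Y : preTopologicalLmodType R) (G : set (set Y))
  (sG : sigma_algebra [set: Y] G)
  (fundY : forall y : measurable_lmod sG,
    fundamental_system y (open_convex_nbhs sG y))
  (f : {mfun measurable_lmod sF >-> measurable_lmod sG})
  (f_cont : continuous f) (f_lin : linear f) :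
  SAC (fun n => distribution (mu n) f) v (open_convex_nbhs sG).
Proof.
case: SAC_mu => _ _ eq_mu; split=> // [y C [] //|y C [mC oC cC _]].
(* An image measure evaluates on [C] to the mass of the preimage of [C] by
   definition. *)
rewrite (_ : log_rate _ v C = log_rate mu v (f @^-1` C))//.
have [->|/set0P[x Cx]] := eqVneq (f @^-1` C) set0.
  by rewrite limn_einf_log_rate0// limn_esup_log_rate0.
apply: (eq_mu x); split=> //.
- by rewrite -[_ @^-1` _]setTI; exact: measurable_funP.
- by apply: open_comp oC => z _; exact: f_cont.
- exact: convex_set_preimage.
Qed.

(* Sequences start at rank 1: [mu 0] and [v 0] are irrelevant. The divergence of
   [v] is only required for the weak large deviations principle, which fails
   without it: take [X = Y = R] with its Borel sets, [f] the identity, [v] the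
   constant 1, [mu n] the uniform measure on {0, 1} and [K = {0, 1}]. *)
Theorem mainTheorem3 (R : realType)
  (X : preTopologicalLmodType R) (F : set (set X))
  (sF : sigma_algebra [set: X] F) (hausX : hausdorff_space X)
  (mu : nat -> probability (measurable_lmod sF) R) (v : nat -> R)
  (v_gt0 : forall n, (1 <= n)%N -> 0 < v n)
  (SAC_mu : SAC mu v (open_convex_nbhs sF))
  (Y : preTopologicalLmodType R) (G : set (set Y))
  (sG : sigma_algebra [set: Y] G) (hausY : hausdorff_space Y)
  (fundY : forall y : measurable_lmod sG,
    fundamental_system y (open_convex_nbhs sG y))
  (f : {mfun measurable_lmod sF >-> measurable_lmod sG})
  (f_cont : continuous f) (f_lin : linear f) :
  SAC (fun n => distribution (mu n) f) v (open_convex_nbhs sG) /\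
  (v @ \oo --> +oo -> weak_LDP (fun n => distribution (mu n) f) v).
Proof.
have SAC_f := SAC_distribution_linear v_gt0 SAC_mu fundY f_cont f_lin.
by split=> //; exact: SAC_weak_LDP SAC_f.
Qed.
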